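(* Let $\phi\colon\mathbb{C}\to\mathbb{C}$ be a field automorphism which is the extension of an exponential function in $S_1^*$ (i.e. $\phi|_{K^*}\in S_1^*$), and let $$D=\sum_{j_1=0}^{J_1}\cdots\sum_{j_k=0}^{J_k}c_{j_1\ldots j_k}\,\partial_1^{j_1}\cdots\partial_k^{j_k}\qquad(c_{j_1\ldots j_k}\in\mathbb{C})$$ be a differential operator on $K$. (1) Suppose that $\tilde f=\phi\circ D\colon K\to\mathbb{C}$ is nonzero and that, for some $\tilde c\in\mathbb{C}$, $$\sum_{i=1}^n a_i\tilde f(\alpha_ix+\beta_iy)=\tilde c\cdot(x+y)\qquad(x,y\in K).$$ If $\tilde c\neq0$, then $\phi(x)=x$ for all $x\in K$, $$\text{(A)}\quad \sum_{i=1}^n a_iD^{\phi}_{m_1\ldots m_k}(\alpha_i)=\sum_{i=1}^n a_iD^{\phi}_{m_1\ldots m_k}(\beta_i)=0$$ for all integers $0\le m_1\le J_1,\ldots,0\le m_k\le J_k$ with $m_1+\cdots+m_k\ge1$, and $$\text{(B)}\quad \sum_{i=1}^n a_iD^{\phi}(\alpha_i)=\sum_{i=1}^n a_iD^{\phi}(\beta_i)=\tilde c.$$ (2) Conversely, if $\tilde c\ne0$ and (A) and (B) hold, then for every nonzero $c\in\mathbb{C}$ the function $f:=(c/\tilde c)\cdot D^{\phi}$ is a nonzero additive solution of $$\sum_{i=1}^n a_if(\alpha_ix+\beta_iy)=c\cdot(x+y)\qquad(x,y\in K).$$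
   Context: Let $n\ge1$ and $a_i,\alpha_i,\beta_i\in\mathbb{C}$ ($i=1,\ldots,n$). Suppose $\mathbb{Q}(\alpha_1,\ldots,\alpha_n,\beta_1,\ldots,\beta_n)$ has transcendence degree $k\geq 1$ over $\mathbb{Q}$. Let $t_1,\ldots,t_k\in\mathbb{C}$ be algebraically independent over $\mathbb{Q}$ such that the algebraic closure of $L=\mathbb{Q}(t_1,\ldots,t_k)$ in $\mathbb{C}$ contains all $\alpha_i,\beta_i$. Let $K\subset\mathbb{C}$ be a finitely generated field containing all $\alpha_i,\beta_i$, with $L\subset K$ and $K$ contained in the algebraic closure of $L$. Put $K^*=K\setminus\{0\}$. $S_1$ is the set of additive functions $g\colon K\to\mathbb{C}$ for which there is a constant $c_g\in\mathbb{C}$ with $\sum_{i=1}^n a_ig(\alpha_ix+\beta_iy)=c_g(x+y)$ for all $x,y\in K$; $S_1^*=\{g|_{K^*}: g\in S_1\}$. An exponential function on $K^*$ is a multiplicative function $K^*\to\mathbb{C}$. $\partial_j$ denotes the derivation $\partial/\partial t_j$ of $L$, extended uniquely to a derivation of the algebraic closure of $L$ (it maps $K$ into $K$); zero powers are the identity. A differential operator $D$ as in the claim is regarded as a map $K\to\mathbb{C}$ in this way. For $0\le m_1\le J_1,\ldots,0\le m_k\le J_k$, $$D_{m_1\ldots m_k}:=\sum_{j_1=m_1}^{J_1}\cdots\sum_{j_k=m_k}^{J_k}c_{j_1\ldots j_k}\binom{j_k}{m_k}\cdots\binom{j_1}{m_1}\,\partial_1^{j_1-m_1}\cdots\partial_k^{j_k-m_k},$$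 so $D_{0\ldots0}=D$. For a differential operator $E$ written in this form, $E^{\phi}$ is the differential operator obtained from $E$ by replacing every coefficient by its image under $\phi$; so $D^{\phi}$ has coefficients $\phi(c_{j_1\ldots j_k})$, and $D^{\phi}_{m_1\ldots m_k}$ is obtained from $D_{m_1\ldots m_k}$ by replacing each $c_{j_1\ldots j_k}$ by $\phi(c_{j_1\ldots j_k})$. *)

(* Defs.v *)
From HB Require Import structures.
From mathcomp Require Import all_boot all_order all_algebra.
From mathcomp Require Import boolp classical_sets reals.
From mathcomp Require Export complex.
(* The notations of [mpoly] clash with those of [classical_sets]. *)
From mathcomp Require Import -(notations) mpoly.

Set Implicit Arguments.
Unset Strict Implicit.
Unset Printing Implicit Defensive.

Import GRing.Theory.
Local Open Scope classical_set_scope.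
Local Open Scope ring_scope.

Section FieldTheory.
Variable F : fieldType.
Implicit Types (A S : set F) (x : F).

Definition is_subfield A : Prop := GRing.divring_closed (mem A).

Definition field_gen S : set F := smallest is_subfield S.

Definition finitely_generated_field A : Prop :=
  exists s : seq F, A = field_gen [set` s].

Definition algebraic_over A x : Prop :=
  exists2 p : {poly F}, p != 0 & p \is a polyOver (mem A) /\ root p x.

Definition algebraic_closure_of A : set F := [set x | algebraic_over A x].

Definition eval_rat (k : nat) (t : 'I_k -> F) (p : mpoly k rat) : F :=
  mmap ratr t p.

Definition algebraically_independent (k : nat) (t : 'I_k -> F) : Prop :=
  forall p : mpoly k rat, eval_rat t p = 0 -> p = 0.

Definition has_trdeg A (k : nat) : Prop :=
  exists s : 'I_k -> F,
    [/\ forall i, A (s i), algebraically_independent s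
      & A `<=` algebraic_closure_of (field_gen (range s))].

Definition additive_on A (f : F -> F) : Prop :=
  {in A &, {morph f : x y / x + y}}.

Definition derivation_on A (d : F -> F) : Prop :=
  [/\ {in A, forall x, d x \in A}, additive_on A d
    & {in A &, forall x y, d (x * y) = d x * y + x * d y}].

(* On the field generated by [t], [d] is the partial derivative of rational
   functions, by the quotient rule; being a derivation of the algebraic
   closure of that field then determines [d] there. Nothing is required of
   [d] elsewhere. *)
Definition extends_partial (k : nat) (t : 'I_k -> F) (j : 'I_k) (d : F -> F)
    : Prop :=
  derivation_on (algebraic_closure_of (field_gen (range t))) d /\
  forall p q : mpoly k rat, eval_rat t q != 0 ->
    d (eval_rat t p / eval_rat t q) =
    (eval_rat t (mderiv j p) * eval_rat t q
     - eval_rat t p * eval_rat t (mderiv j q)) / eval_rat t q ^+ 2.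

(* Functions on [A], and on its nonzero elements, are represented by total
   functions of which only the values there matter. *)
Section Equation.
Variables (A : set F) (n : nat) (a alpha beta : 'I_n -> F).

Definition solves (f : F -> F) (c : F) : Prop :=
  {in A &, forall x y,
    \sum_i a i * f (alpha i * x + beta i * y) = c * (x + y)}.

Definition S1 : set (F -> F) :=
  [set g | additive_on A g /\ exists c, solves g c].

Definition S1star : set (F -> F) :=
  [set m | exists2 g, S1 g & {in A, forall x, x != 0 -> m x = g x}].

Definition exponential_on_star (m : F -> F) : Prop :=
  {in A &, forall x y, x != 0 -> y != 0 -> m (x * y) = m x * m y}.

Definition extends_exponential_of_S1star (phi : F -> F) : Prop :=
  exists m, [/\ exponential_on_star m, S1star m
              & {in A, forall x, x != 0 -> phi x = m x}].

End Equation.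

Section DifferentialOperators.
Variables (k : nat) (J : 'I_k -> nat).

Definition multi_index := {dffun forall i : 'I_k, 'I_(J i).+1}.

Implicit Types (c : multi_index -> F) (d : 'I_k -> F -> F).

Definition iterated_partial d (e : 'I_k -> nat) : F -> F :=
  \big[(fun f g => f \o g)/idfun]_(i < k) iter (e i) (d i).

Definition diff_op d c (x : F) : F :=
  \sum_(j : multi_index) c j * iterated_partial d (fun i => j i) x.

Definition diff_op_shift d c (m : multi_index) (x : F) : F :=
  \sum_(j : multi_index | [forall i, m i <= j i]%N)
    c j * (\prod_(i < k) 'C(j i, m i))%:R
        * iterated_partial d (fun i => j i - m i)%N x.

End DifferentialOperators.

End FieldTheory.

(* Main.v *)
(* Leibniz' rule gives [D (g x) = \sum_m D_m(g) d^m x], where the [D_m] are the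
   shifted operators. So with [y = 0] the functional equation for [phi o D]
   becomes [\sum_m A_m phi (d^m x) = ct x] with
   [A_m = \sum_i a_i phi (D_m(alpha_i))]. If [ct != 0], this exhibits the
   inverse of [phi] on [K] as a differential operator with coefficients
   [phi^-1 (A_m / ct)]. A multiplicative differential operator is the identity,
   because the [d^m] are linearly independent; hence [phi = id] on [K] and, by
   independence again, [A_m = 0] for [m != 0] and [A_0 = ct]. Reading the same
   expansion backwards gives the converse. *)
From HB Require Import structures.
Require Import Defs.
From mathcomp Require Import all_boot all_order all_algebra.
From mathcomp Require Import boolp classical_sets reals.
From mathcomp Require Import -(notations) mpoly.
From mathcomp Require Import ring.
Import GRing.Theory.
Local Open Scope classical_set_scope.
Local Open Scope ring_scope.

Set Implicit Arguments.
Unset Strict Implicit.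
Unset Printing Implicit Defensive.

(** * Subfields and derivations on them *)

Section Subfields.
Variable F : fieldType.
Implicit Types (A B S : set F) (d : F -> F).

(* A convertible copy of [mem A], on which the [rpred] lemmas can be used. *)
Definition subfield_pred A of is_subfield A : {pred F} := mem A.

HB.instance Definition _ A (hA : is_subfield A) :=
  GRing.isDivringClosed.Build F (subfield_pred hA) hA.

Lemma field_gen_subfield S : is_subfield (field_gen S).
Proof.
split=> [|x y|x y].
- by apply/mem_set => A [[hA _ _] _]; apply/set_mem.
- move=> /set_mem hx /set_mem hy; apply/mem_set => A hA.
  by apply/set_mem; case: (hA.1) => _ + _; apply; apply/mem_set;
    [apply: hx | apply: hy].
- move=> /set_mem hx /set_mem hy; apply/mem_set => A hA.
  by apply/set_mem; case: (hA.1) => _ _; apply; apply/mem_set;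
    [apply: hx | apply: hy].
Qed.

Section Derivation.
Variables (A : set F) (hA : is_subfield A) (d : F -> F).
Hypothesis dD : additive_on A d.
Hypothesis dM : {in A &, forall x y, d (x * y) = d x * y + x * d y}.
Let SA := subfield_pred hA.

Let A0 : 0 \in A. Proof. exact: (rpred0 SA). Qed.
Let A1 : 1 \in A. Proof. exact: (rpred1 SA). Qed.

Lemma der0 : d 0 = 0.
Proof. by apply: (addIr (d 0)); rewrite -dD // !add0r. Qed.

Lemma der1 : d 1 = 0.
Proof.
by apply: (addIr (d 1)); rewrite add0r -[in RHS](mulr1 1) dM // mul1r mulr1.
Qed.

Lemma derB : {in A &, {morph d : x y / x - y}}.
Proof.
move=> x y hx hy; apply: (addIr (d y)).
by rewrite -dD ?subrK //; apply: (@rpredB _ SA).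
Qed.

Lemma der_div x y : x \in A -> y \in A -> y != 0 ->
  d (x / y) = (d x - x / y * d y) / y.
Proof.
move=> hx hy y0; have hxy : x / y \in A by apply: (@rpred_div _ SA).
have := dM hxy hy; rewrite divfK // => ->.
by rewrite addrK mulfK.
Qed.

(** The witness [r] is [p] with [d] applied to each coefficient; later only the fact that its
    coefficients stay in [B] matters. *)
Lemma der_horner B (hB : is_subfield B) (p : {poly F}) x :
    B `<=` A -> {in B, forall b, d b \in B} ->
    p \is a polyOver (subfield_pred hB) -> x \in A ->
  exists2 r : {poly F}, r \is a polyOver (subfield_pred hB)
    & d p.[x] = r.[x] + p^`().[x] * d x.
Proof.
move=> BA dB + hx; have BAm b : b \in B -> b \in A.
  by move=> /set_mem/BA/mem_set.
elim/poly_ind: p => [_|p c IH hp].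
  by exists 0; [exact: rpred0 | rewrite deriv0 !horner0 der0 mul0r addr0].
have hc : c \in B.
  by move/polyOverP: hp => /(_ 0%N); rewrite coefD coefMX coefC /= add0r.
have hpB : p \is a polyOver (subfield_pred hB).
  apply/polyOverP => i.
  by move/polyOverP: hp => /(_ i.+1); rewrite coefD coefMX coefC /= addr0.
have [r hr er] := IH hpB.
exists (r * 'X + (d c)%:P).
  by rewrite rpredD ?rpredM ?polyOverX ?polyOverC //; apply: dB.
have hpx : p.[x] \in SA.
  apply: rpred_horner => //.
  by apply/polyOverP => i; apply: BAm; move/polyOverP: hpB; apply.
rewrite !derivE !hornerE dD ?dM ?er //; last 2 first.
- by apply: (@rpredM _ SA).
- exact: BAm.
by ring.
Qed.

(** Differentiating [p.[x] = 0] gives [r.[x] + p'.[x] * d x = 0], which can be solved for [d x] when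
    [p'.[x]] is nonzero. Otherwise the derivative of [p] is a smaller nonzero annihilator of [x], so
    induction on the size of [p] ends in the first case. *)
Lemma der_algebraic B (hB : is_subfield B) x : [pchar F] =i pred0 ->
    B `<=` A -> {in B, forall b, d b \in B} ->
    x \in A -> algebraic_over B x -> d x \in A.
Proof.
move=> F0 BA dB hx [p p0 [hp0 rp]].
have {hp0} hp : p \is a polyOver (subfield_pred hB) by [].
have [n] := ubnP (size p); elim: n p p0 hp rp => // n IH p p0 hp rp szp.
have subA q : q \is a polyOver (subfield_pred hB) -> q.[x] \in SA.
  move=> /polyOverP hq; apply: rpred_horner => //.
  by apply/polyOverP => i; apply/mem_set/BA/set_mem/hq.
have hp' : p^`() \is a polyOver (subfield_pred hB) by exact: polyOver_deriv.
have [rp'|rp'] := boolP (root p^`() x).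
  apply: (IH p^`()) => //; last first.
    by apply: leq_trans (lt_size_deriv p0) _.
  have sz1 : (1 < size p)%N by apply: root_size_gt1 rp.
  apply/eqP => /(congr1 (fun q : {poly F} => q`_(size p).-2)).
  (* The top coefficient of the derivative is the lead coefficient of [p] times its degree, which is
     nonzero in characteristic 0. *)
  rewrite coef_deriv coef0 -mulr_natr => /eqP.
  have -> : (size p).-2.+1 = (size p).-1 by case: (size p) sz1 => [|[]].
  rewrite mulf_eq0 -lead_coefE lead_coef_eq0 (negPf p0) /=.
  by move=> /natf0_pchar [|q]; [case: (size p) sz1 => [|[]] | rewrite F0].
have [r hr er] := der_horner BA dB hp hx.
move: er; rewrite (eqP rp) der0 => /esym/eqP; rewrite addrC addr_eq0 => /eqP er.
have -> : d x = - r.[x] / p^`().[x] by rewrite -er mulrC mulKf.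
by apply: (@rpred_div _ SA); rewrite ?rpredN subA.
Qed.

End Derivation.

Lemma der_sum A (hA : is_subfield A) d (dD : additive_on A d)
    I (r : seq I) (P : pred I) (G : I -> F) :
    (forall i, P i -> G i \in A) ->
  d (\sum_(i <- r | P i) G i) = \sum_(i <- r | P i) d (G i).
Proof.
(* Additivity of [d] is available only inside [A], so membership of the partial sums is carried
   through the induction. *)
move=> hG; pose Q u v := u \in A /\ d u = v.
suff: Q (\sum_(i <- r | P i) G i) (\sum_(i <- r | P i) d (G i)) by case.
apply: big_rec2 => [|i u v Pi [hu <-]].
  by split; [exact: (rpred0 (subfield_pred hA)) | exact: (der0 hA dD)].
split; last by rewrite dD ?hG.
by apply: (@rpredD _ (subfield_pred hA)) => //; apply: hG.
Qed.

(** * Leibniz' rule for mixed partials and differential operators *)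

Section MixedPartials.
Variables (A : set F) (hA : is_subfield A) (k : nat) (d : 'I_k -> F -> F).
Hypothesis hd : forall i, derivation_on A (d i).
Let SA := subfield_pred hA.

Let dA i : {in A, forall x, d i x \in A}. Proof. by case: (hd i). Qed.
Let dD i : additive_on A (d i). Proof. by case: (hd i). Qed.
Let dM i : {in A &, forall x y, d i (x * y) = d i x * y + x * d i y}.
Proof. by case: (hd i). Qed.

Lemma iter_der_in n i : {in A, forall x, iter n (d i) x \in A}.
Proof. by move=> x hx; elim: n => //= n IH; apply: dA. Qed.

Lemma iter_der_additive n i : additive_on A (iter n (d i)).
Proof. by move=> x y hx hy; elim: n => //= n ->; rewrite dD ?iter_der_in. Qed.

Lemma iter_derMn n i x m : x \in A ->
  iter n (d i) (x *+ m) = iter n (d i) x *+ m.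
Proof.
move=> hx; elim: m => [|m IH].
  by rewrite !mulr0n (der0 hA (@iter_der_additive n i)).
by rewrite !mulrS iter_der_additive ?IH //; apply: (@rpredMn _ SA).
Qed.

(* The upper summation bound may exceed [n], the extra binomials being zero. *)
Lemma iter_derM i N n x y : (n <= N)%N -> x \in A -> y \in A ->
  iter n (d i) (x * y) =
  \sum_(v < N.+1) (iter (n - v) (d i) x * iter v (d i) y) *+ 'C(n, v).
Proof.
move=> nN hx hy; elim: n nN => [_|n IH nN].
  rewrite big_ord_recl big1 ?addr0 //= => v _.
have hxy a b : iter a (d i) x * iter b (d i) y \in A.
  by apply: (@rpredM _ SA); apply: iter_der_in.
have -> : iter n.+1 (d i) (x * y) =
    \sum_(v < N.+1) ((iter (n - v).+1 (d i) x * iter v (d i) y) *+ 'C(n, v)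
       + (iter (n - v) (d i) x * iter v.+1 (d i) y) *+ 'C(n, v)).
  rewrite iterS IH ?(ltnW nN) // (der_sum hA (@dD i)).
    apply: eq_bigr => v _; rewrite -mulrnDl -dM ?iter_der_in //.
    exact: (iter_derMn 1).
  by move=> v _; apply: (@rpredMn _ SA); apply: hxy.
(* Peel off the term [v = 0] of the first sum and the term [v = N] of the second, which vanishes
   because [n < N]; the remaining terms match after a shift and combine by Pascal's rule. *)
rewrite big_split /= big_ord_recl /= [X in _ + X]big_ord_recr /=.
rewrite (bin_small nN) mulr0n addr0 [RHS]big_ord_recl /= !bin0 !subn0 -addrA.
congr (_ + _); rewrite -big_split /=; apply: eq_bigr => v _.
rewrite /bump /= !add1n subSS binS mulrnDr; congr (_ + _).
(* Truncated subtraction gives [(n - v.+1).+1 = n - v] only for [v < n]; for the other [v] the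
   binomial is zero. *)
have [vn|nv] := ltnP v n; last by rewrite bin_small ?mulr0n.
by rewrite -iterS -subSn // subSS.
Qed.

(** Allowing an arbitrary list of variables makes Leibniz' rule provable by induction on the list;
    [iterated_partial] is the case of the full enumeration. *)
Definition partials (r : seq 'I_k) (e : 'I_k -> nat) : F -> F :=
  \big[(fun f g => f \o g)/idfun]_(i <- r) iter (e i) (d i).

Lemma partials_cons i r e x :
  partials (i :: r) e x = iter (e i) (d i) (partials r e x).
Proof. by rewrite /partials big_cons. Qed.

Lemma eq_partials r e1 e2 : {in r, e1 =1 e2} ->
  partials r e1 = partials r e2.
Proof. by move=> e12; apply: eq_big_seq => i /e12 ->. Qed.

Lemma partials_in r e : {in A, forall x, partials r e x \in A}.
Proof.
move=> x hx; elim: r => [|i r IH]; first by rewrite /partials big_nil.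
by rewrite partials_cons iter_der_in.
Qed.

Lemma partials_additive r e : additive_on A (partials r e).
Proof.
move=> x y hx hy; elim: r => [|i r IH]; first by rewrite /partials big_nil.
by rewrite !partials_cons IH iter_der_additive ?partials_in.
Qed.

Variable J : 'I_k -> nat.
Implicit Types m : multi_index J.

Definition zero_index : multi_index J := [ffun i : 'I_k => ord0].

Definition set_index m i (v : 'I_(J i).+1) : multi_index J :=
  [ffun j => dfwith m v j].

Lemma set_index_in m i v : set_index m (i := i) v i = v.
Proof. by rewrite ffunE dfwith_in. Qed.

Lemma set_index_out m i v j : i != j -> set_index m (i := i) v j = m j.
Proof. by move=> ij; rewrite ffunE dfwith_out. Qed.

(** A multi-index in the variables of [r] alone is encoded as a full one vanishing elsewhere, so
    that its type stays fixed during the induction on [r]. *)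
Definition supported (r : seq 'I_k) m : bool :=
  [forall i, (i \notin r) ==> (m i == ord0)].

Lemma sum_supported_cons i r (G : multi_index J -> F) : i \notin r ->
  \sum_(m | supported (i :: r) m) G m =
  \sum_(m | supported r m) \sum_(v < (J i).+1) G (set_index m v).
Proof.
move=> ir; rewrite (partition_big (fun m => m i) predT) //= exchange_big /=.
apply: eq_bigr => v _.
(* For a fixed entry [v] at [i], the inverse correspondence resets that entry to 0, the value it has
   in every index supported on [r]. *)
rewrite (reindex_onto (fun m => set_index m v)
                      (fun m => set_index m (@ord0 (J i)))) /=; last first.
  move=> m /andP[_ /eqP mi]; apply/ffunP => j; have [<-|ij] := eqVneq i j.
    by rewrite set_index_in.
  by rewrite !set_index_out.
apply: eq_bigl => m; rewrite set_index_in eqxx andbT.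
apply/andP/idP => [[/forallP ms /eqP me]|/forallP ms].
  apply/forallP => j; apply/implyP => jr; have [<-|ij] := eqVneq i j.
    by rewrite -me set_index_in.
  have /implyP := ms j; rewrite inE negb_or jr eq_sym ij => /(_ isT).
  by rewrite set_index_out.
split.
  apply/forallP => j; apply/implyP; rewrite inE negb_or eq_sym => /andP[ij jr].
  by rewrite set_index_out //; exact: (implyP (ms j)).
apply/eqP/ffunP => j; have [<-|ij] := eqVneq i j.
  by rewrite set_index_in; apply/esym/eqP; exact: (implyP (ms i)).
by rewrite !set_index_out.
Qed.

(** Induction on [r]: the one-variable rule is applied to the outermost variable in each term of the
    expansion for the tail. As [i] is not in the tail, changing entry [i] leaves the tail's partials
    and binomials alone. *)
Lemma partialsM r (e : 'I_k -> nat) x y : (forall i, e i <= J i)%N ->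
    uniq r -> x \in A -> y \in A ->
  partials r e (x * y) =
  \sum_(m | supported r m)
    (partials r (fun i => e i - m i)%N x * partials r (fun i => m i) y)
      *+ (\prod_(i <- r) 'C(e i, m i)).
Proof.
move=> eJ + hx hy; elim: r => [_|i r IH /= /andP[ir ur]].
  rewrite (big_pred1 zero_index) => [|m].
    by rewrite /partials !big_nil.
  apply/forallP/eqP => [ms|-> j]; last by rewrite ffunE eqxx implybT.
  by apply/ffunP => j; rewrite ffunE; apply/eqP; exact: (implyP (ms j)).
have hxy m :
    partials r (fun i => e i - m i)%N x * partials r (fun i => m i) y \in A.
  by apply: (@rpredM _ SA); apply: partials_in.
rewrite partials_cons IH // (der_sum hA (@iter_der_additive _ _)); last first.
  by move=> m _; apply: (@rpredMn _ SA); apply: hxy.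
rewrite sum_supported_cons //; apply: eq_bigr => m _.
rewrite iter_derMn // (@iter_derM i (J i)) ?partials_in //.
rewrite -sumrMnl; apply: eq_bigr => v _.
have out j : j \in r -> set_index m v j = m j.
  by move=> jr; rewrite set_index_out //; apply: contraNneq ir => ->.
rewrite !partials_cons set_index_in big_cons set_index_in -mulrnA.
congr (_ * _ *+ (_ * _)).
- by congr iter; apply: (congr1 (@^~ x)); apply: eq_partials => j /out ->.
- by congr iter; apply: (congr1 (@^~ y)); apply: eq_partials => j /out ->.
- by apply: eq_big_seq => j /out ->.
Qed.

Lemma iterated_partial_in e : {in A, forall x, iterated_partial d e x \in A}.
Proof. exact: partials_in. Qed.

Lemma iterated_partial_additive e : additive_on A (iterated_partial d e).
Proof. exact: partials_additive. Qed.

Lemma diff_op_additive (c : multi_index J -> F) : additive_on A (diff_op d c).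
Proof.
move=> x y hx hy; rewrite /diff_op -big_split /=; apply: eq_bigr => j _.
by rewrite -mulrDr iterated_partial_additive.
Qed.

Lemma diff_opM (c : multi_index J -> F) x y : x \in A -> y \in A ->
  diff_op d c (x * y) =
  \sum_m diff_op_shift d c m x * iterated_partial d (fun i => m i) y.
Proof.
move=> hx hy; under [RHS]eq_bigr do rewrite /diff_op_shift mulr_suml big_mkcond.
rewrite exchange_big; apply: eq_bigr => j _.
have jJ i : (j i <= J i)%N by rewrite -ltnS.
rewrite [iterated_partial _ _ _](partialsM jJ (index_enum_uniq _) hx hy).
rewrite mulr_sumr; apply: eq_big => [m|m _].
  by apply/forallP => i; rewrite mem_index_enum.
case: ifPn => [_|].
  by rewrite -mulr_natl mulrA mulrA.
(* The indices [m] omitted from the shifted operator have [j l < m l] for some [l], hence a zero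
   binomial factor. *)
move=> /forallPn[l]; rewrite -ltnNge => jl.
by rewrite (bigD1 l) //= bin_small // mul0n mulr0n mulr0.
Qed.

Lemma diff_op_shift0 (c : multi_index J -> F) :
  diff_op_shift d c zero_index =1 diff_op d c.
Proof.
move=> x; apply: eq_big => [j|j _]; first by apply/forallP => i; rewrite ffunE.
rewrite big1 => [|i _]; last by rewrite ffunE bin0.
rewrite mulr1; congr (_ * _); apply: (congr1 (@^~ x)).
by apply: eq_partials => i _; rewrite ffunE subn0.
Qed.

End MixedPartials.
End Subfields.

(** * Partial derivatives on the field generated by [t] and on algebraic extensions of it *)

Section PartialDerivatives.
Variables (F : numFieldType) (k : nat) (t : 'I_k -> F).
Implicit Types p : mpoly k rat.

Let L := field_gen (range t).
Let hL : is_subfield L := field_gen_subfield (range t).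
Let SL := subfield_pred hL.

Lemma eval_rat1 : eval_rat t 1 = 1.
Proof. exact: rmorph1. Qed.

Lemma eval_rat_in p : eval_rat t p \in L.
Proof.
apply: (rpred_sum (S := SL)) => m _; apply: rpredM; first exact: rpred_rat.
apply: rpred_prod => i _; apply: rpredX.
by apply/mem_set; apply: sub_gen_smallest; apply: imageT.
Qed.

Lemma field_gen_algebraic : L `<=` algebraic_closure_of L.
Proof.
move=> x Lx; exists ('X - x%:P); first by rewrite polyXsubC_eq0.
split; last by rewrite root_XsubC.
suff : 'X - x%:P \is a polyOver SL by [].
by rewrite polyOverXsubC; apply/mem_set.
Qed.

Lemma extends_partial_eval j d p : extends_partial t j d ->
  d (eval_rat t p) = eval_rat t (mderiv j p).
Proof.
case=> _ /(_ p 1); rewrite eval_rat1 oner_eq0 divr1 => -> //.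
by rewrite -mpolyC1 mderivC /eval_rat raddf0 mulr0 subr0 mulr1 expr1n divr1.
Qed.

(** The elements of [L] that [d] sends into [L] form a subfield containing every [t i], and [L] is
    the smallest subfield that does. *)
Lemma extends_partial_field_gen j d : extends_partial t j d ->
  {in L, forall x, d x \in L}.
Proof.
move=> hd; have [[_ dD dM] _] := hd.
have clos x : x \in L -> x \in algebraic_closure_of L.
  by move=> /set_mem/field_gen_algebraic/mem_set.
have dDL : additive_on L d by move=> x y /clos hx /clos hy; apply: dD.
have dML : {in L &, forall x y, d (x * y) = d x * y + x * d y}.
  by move=> x y /clos hx /clos hy; apply: dM.
pose B := [set x | x \in L /\ d x \in L].
suff LB : L `<=` B by move=> x /set_mem hx; have [] := LB x hx.
apply: smallest_sub => [|x [i _ <-]]; last first.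
  have -> : t i = eval_rat t (mpolyX rat (mnm1 i)).
    by rewrite /eval_rat mmapX mmap1U.
  split; first exact: eval_rat_in.
  by rewrite (extends_partial_eval _ hd) eval_rat_in.
split=> [|x y /set_mem[hx dx] /set_mem[hy dy]
          |x y /set_mem[hx dx] /set_mem[hy dy]].
- apply/mem_set; split; first exact: (rpred1 SL).
  by rewrite (der1 hL dML); apply: (rpred0 SL).
- by apply/mem_set; split; rewrite ?(derB hL dDL) //; apply: (@rpredB _ SL).
apply/mem_set; split; first exact: (@rpred_div _ SL).
have [->|y0] := eqVneq y 0.
  by rewrite invr0 mulr0 (der0 hL dDL); apply: (rpred0 SL).
rewrite (der_div hL dML) //; apply: (@rpred_div _ SL) => //.
apply: (@rpredB _ SL) => //; apply: (@rpredM _ SL) => //.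
exact: (@rpred_div _ SL).
Qed.

(** The point is that [d] maps [K] into itself: it preserves [L], and [K] is algebraic over [L], so
    [der_algebraic] applies. *)
Lemma extends_partial_derivation K j d : is_subfield K ->
    L `<=` K -> K `<=` algebraic_closure_of L ->
  extends_partial t j d -> derivation_on K d.
Proof.
move=> hK LK KL hd; have [[_ dD dM] _] := hd.
have clos x : x \in K -> x \in algebraic_closure_of L.
  by move=> /set_mem/KL/mem_set.
have dDK : additive_on K d by move=> x y /clos hx /clos hy; apply: dD.
have dMK : {in K &, forall x y, d (x * y) = d x * y + x * d y}.
  by move=> x y /clos hx /clos hy; apply: dM.
split=> // x hx; apply: (der_algebraic hK dDK dMK hL) => //.
- exact: Num.Theory.pchar_num.
- exact: extends_partial_field_gen hd.
- by apply/set_mem/clos.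
Qed.

Variable d : 'I_k -> F -> F.
Hypothesis hd : forall j, extends_partial t j (d j).

Lemma iterated_partial_eval (e : multinom k) p :
  iterated_partial d (fun i => e i) (eval_rat t p) = eval_rat t (mderivm e p).
Proof.
rewrite /iterated_partial /mderivm /index_enum -enumT.
elim: (enum _) => [|i r IH]; first by rewrite big_nil.
rewrite big_cons /= IH; elim: (e i) => //= n ->.
exact: extends_partial_eval.
Qed.

(** * Linear independence of the mixed partials, tested on monomials in [t] *)

Variable J : 'I_k -> nat.

Definition mnm_of_index (m : multi_index J) : multinom k :=
  Multinom (mktuple (fun i => m i : nat)).

Definition monomial (m : multi_index J) : F :=
  eval_rat t (mpolyX rat (mnm_of_index m)).

Lemma iterated_partial_monomial (e m : multi_index J) :
  iterated_partial d (fun i => e i) (monomial m) =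
  (\prod_(i < k) (m i ^_ e i))%:R
    * eval_rat t (mpolyX rat (mnm_sub (mnm_of_index m) (mnm_of_index e))).
Proof.
have -> : iterated_partial d (fun i => e i)
    = iterated_partial d (fun i => mnm_of_index e i).
  by apply: eq_partials => i _; rewrite mnmE.
rewrite iterated_partial_eval mderivmX /eval_rat mmapZ rmorph_nat.
by congr (_%:R * _); apply: eq_bigr => i _; rewrite !mnmE.
Qed.

(* Test the operator on the monomial [m], with the coefficients of lower degree
   already known to vanish: only [j = m] contributes, with the value [m!]. *)
Lemma iterated_partials_free (c : multi_index J -> F) :
  (forall m, diff_op d c (monomial m) = 0) -> forall m, c m = 0.
Proof.
move=> hc m; have [n] := ubnP (\sum_i m i)%N.
elim: n m => // n IH m mn.
have := hc m; rewrite /diff_op (bigD1 m) //= big1 ?addr0 => [|j jm].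
  rewrite iterated_partial_monomial.
  have -> : mnm_sub (mnm_of_index m) (mnm_of_index m) = mnm0.
    by apply/mnmP => i; rewrite !mnmE subnn.
  rewrite mpolyX0 eval_rat1 mulr1 => /eqP; rewrite mulf_eq0.
  move=> /orP[/eqP //|]; rewrite Num.Theory.pnatr_eq0 => /eqP h.
  have : (0 < \prod_(i < k) m i ^_ m i)%N.
    by apply: prodn_gt0 => i; rewrite ffactnn fact_gt0.
  by rewrite h.
rewrite iterated_partial_monomial.
(* If some [j l] exceeds [m l], differentiation kills the monomial. Otherwise [j] is below [m] and
   different from it, so its degree is strictly smaller and the induction hypothesis gives
   [c j = 0]. *)
have [/forallP jlem|/forallPn[l]] := boolP [forall i, (j i <= m i)%N];
  last first.
  rewrite -ltnNge => ml.
  by rewrite (bigD1 l) //= ffact_small // mul0n mul0r mulr0.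
rewrite IH ?mul0r //; apply: leq_trans (mn : _ <= n)%N.
rewrite ltn_neqAle leq_sum // andbT; apply: contraNneq jm => eqs.
have := leqif_sum (fun i (_ : predT i) => leqif_eq (jlem i)).
move=> [_]; rewrite eqs eqxx => /esym/forallP h.
by apply/eqP/ffunP => i; apply/val_inj/eqP; exact: (h i).
Qed.

Lemma index_sum_gt0 (m : multi_index J) :
  (1 <= \sum_i m i)%N = (m != zero_index J).
Proof.
rewrite lt0n sum_nat_eq0; congr (~~ _).
apply/forallP/eqP => [m0|-> i]; last by rewrite ffunE.
by apply/ffunP => i; apply/val_inj; rewrite ffunE; apply/eqP; exact: (m0 i).
Qed.

Lemma iterated_partial0 x : iterated_partial d (fun i => zero_index J i) x = x.
Proof.
rewrite /iterated_partial; apply: (big_rec (fun f : F -> F => f x = x)) => //.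
by move=> i f _ /= fx; rewrite ffunE.
Qed.

(** * Differential operators on [K] *)

Variables (K : set F) (hK : is_subfield K).
Hypotheses (LK : L `<=` K) (KL : K `<=` algebraic_closure_of L).
Let SK := subfield_pred hK.

Let dK j : derivation_on K (d j).
Proof. exact: extends_partial_derivation hK LK KL (hd j). Qed.

Lemma monomial_in m : monomial m \in K.
Proof. by apply/mem_set/LK/set_mem/eval_rat_in. Qed.

(** All test monomials lie in [K], so the difference of the two operators vanishes on them. This is
    what permits comparing coefficients. *)
Lemma diff_op_inj (c1 c2 : multi_index J -> F) :
  {in K, diff_op d c1 =1 diff_op d c2} -> c1 =1 c2.
Proof.
move=> c12 m; apply/eqP; rewrite -subr_eq0; apply/eqP; move: m.
apply: iterated_partials_free => m; apply/eqP.
move/(_ _ (monomial_in m))/eqP: c12; rewrite -subr_eq0 -sumrB.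
by congr (_ == 0); apply: eq_bigr => j _; rewrite mulrBl.
Qed.

(* Multiplicativity turns the Leibniz expansion of [psi (x y)] into
   [E_m y = psi y e_m] for all [m], where [E_m] are the shifted operators; for
   [m] of top degree in the support of [e] the left side is [e_m y]. *)
Lemma multiplicative_diff_op_id (psi : F -> F) (e : multi_index J -> F) :
    {in K &, {morph psi : x y / x * y}} -> psi 1 != 0 ->
    {in K, psi =1 diff_op d e} ->
  {in K, forall x, psi x = x}.
Proof.
move=> psiM psi1 psiE y hy.
have shiftE m : diff_op_shift d e m y = psi y * e m.
  move: m; apply: diff_op_inj => x hx.
  have -> : diff_op d (fun m => psi y * e m) x = psi (y * x).
    rewrite psiM // (psiE x) // /diff_op mulr_sumr.
    by apply: eq_bigr => j _; rewrite mulrA.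
  by rewrite psiE ?(diff_opM hK dK) //; apply: (@rpredM _ SK).
have [m0 em0] : exists m0, e m0 != 0.
  apply/existsP; apply: contraNT psi1 => /existsPn e0.
  rewrite psiE; last exact: (rpred1 SK).
  apply/eqP/big1 => j _.
  by have := e0 j; rewrite negbK => /eqP ->; rewrite mul0r.
pose deg (m : multi_index J) := (\sum_i m i)%N.
have [m em mmax] : exists2 m, e m != 0 &
    forall m', e m' != 0 -> (deg m' <= deg m)%N.
  case: (@arg_maxnP _ m0 (fun m => e m != 0) deg em0) => m em mmax.
  by exists m.
apply: (mulIf em); rewrite -shiftE mulrC /diff_op_shift (bigD1 m) /=;
  last first.
  by apply/forallP.
rewrite [X in X%:R]big1 => [|i _]; last by rewrite binn.
rewrite mulr1 big1 ?addr0 => [|j /andP[/forallP mj jm]].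
  congr (_ * _); rewrite -[RHS]iterated_partial0.
  by apply: (congr1 (@^~ y)); apply: eq_partials => i _; rewrite ffunE subnn.
(* A further index [j] above [m] with [e j != 0] would have the same degree as [m] by maximality,
   hence equal [m]. *)
have [->|ej] := eqVneq (e j) 0; first by rewrite !mul0r.
have le := mmax j ej.
have := leqif_sum (fun i (_ : predT i) => leqif_eq (mj i)).
move=> [le' ]; rewrite eqn_leq le le' => /esym/forallP h.
case/eqP: jm; apply/ffunP => i; apply/val_inj/eqP.
by rewrite eq_sym; exact: (h i).
Qed.

(** * The functional equation in one variable *)

Variables (n : nat) (a : 'I_n -> F) (phi : {rmorphism F -> F}).
Variable c : multi_index J -> F.

Let D := diff_op d c.
Let phiD := diff_op d (fun j => phi (c j)).
Let phiD_ := diff_op_shift d (fun j => phi (c j)).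

(** Stated for a general family [g] so as to serve both [alpha] and [beta]. *)
Lemma solution_diff_op_coef (g : 'I_n -> F) (ct : F) : bijective phi ->
    (forall i, g i \in K) -> ct != 0 ->
    {in K, forall x, \sum_i a i * phi (D (g i * x)) = ct * x} ->
  {in K, forall x, phi x = x} /\
  forall m, \sum_i a i * phiD_ m (g i) = if m == zero_index J then ct else 0.
Proof.
move=> [psi phiK psiK] gK ct0 sol.
pose A m := \sum_i a i * phi (diff_op_shift d c m (g i)).
have solE x : x \in K ->
    \sum_m A m * phi (iterated_partial d (fun i => m i) x) = ct * x.
  move=> hx; rewrite -sol //.
  under eq_bigr do rewrite /A mulr_suml.
  rewrite exchange_big; apply: eq_bigr => i _.
  rewrite /D (diff_opM hK dK) // rmorph_sum mulr_sumr.
  by apply: eq_bigr => m _; rewrite rmorphM mulrA.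
have phi_id : {in K, forall x, phi x = x}.
  suff psi_id : {in K, forall x, psi x = x}.
    by move=> x hx; rewrite -{1}(psi_id x hx) psiK.
  apply: (multiplicative_diff_op_id (e := fun m => psi (A m / ct))).
  - by move=> x y _ _; apply: (can_inj phiK); rewrite rmorphM !psiK.
  - have -> : psi 1 = 1 by apply: (can_inj phiK); rewrite psiK rmorph1.
    exact: oner_neq0.
  move=> x hx; apply: (can_inj phiK); rewrite psiK rmorph_sum.
  apply: (mulfI ct0); rewrite -solE // mulr_sumr; apply: eq_bigr => m _.
  by rewrite rmorphM psiK mulrA mulrCA divff // mulr1.
split=> // m.
(* Since [phi] fixes the derivatives of [g i], which lie in [K], it acts only on the coefficients of
   the shifted operator. *)
have -> : \sum_i a i * phiD_ m (g i) = A m.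
  apply: eq_bigr => i _; congr (_ * _); rewrite rmorph_sum.
  apply: eq_bigr => j _; rewrite !rmorphM rmorph_nat.
  by rewrite [phi (iterated_partial _ _ _)]phi_id // (iterated_partial_in dK).
(* With [phi] the identity on [K], [solE] equates the operator with coefficients [A m] and
   multiplication by [ct], an operator of order 0. *)
move: m; apply: diff_op_inj => x hx.
rewrite [RHS](bigD1 (zero_index J)) //= eqxx big1 => [|m /negPf ->]; last first.
  by rewrite mul0r.
rewrite addr0 iterated_partial0 -solE //; apply: eq_bigr => m _.
by rewrite phi_id // (iterated_partial_in dK).
Qed.

(** In the Leibniz expansion of [phiD (g i * x)], summed against [a], only the index zero survives,
    and its coefficient is [ct]. *)
Lemma diff_op_coef_solution (g : 'I_n -> F) (ct : F) : (forall i, g i \in K) ->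
    (forall m : multi_index J, (1 <= \sum_i m i)%N ->
       \sum_i a i * phiD_ m (g i) = 0) ->
    \sum_i a i * phiD (g i) = ct ->
  {in K, forall x, \sum_i a i * phiD (g i * x) = ct * x}.
Proof.
move=> gK condA condB x hx.
under eq_bigr do rewrite /phiD (diff_opM hK dK) // mulr_sumr.
rewrite exchange_big /= (bigD1 (zero_index J)) //= [X in _ + X]big1 => [|m m0].
  rewrite addr0 -condB mulr_suml; apply: eq_bigr => i _.
  by rewrite diff_op_shift0 iterated_partial0 mulrA.
under eq_bigr do rewrite mulrA.
by rewrite -mulr_suml condA ?index_sum_gt0 // mul0r.
Qed.

End PartialDerivatives.

(** * Both directions for the two-variable equation *)

Theorem proposition3p10 (R : realType) (n : nat) (hn : (1 <= n)%N)
  (a alpha beta : 'I_n -> R[i])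
  (k : nat) (hk : (1 <= k)%N)
  (htr : has_trdeg (field_gen (range alpha `|` range beta)) k)
  (t : 'I_k -> R[i]) (ht : algebraically_independent t)
  (hcl : range alpha `|` range beta
           `<=` algebraic_closure_of (field_gen (range t)))
  (K : set R[i]) (hK : is_subfield K) (hKfg : finitely_generated_field K)
  (hKab : range alpha `|` range beta `<=` K)
  (hLK : field_gen (range t) `<=` K)
  (hKL : K `<=` algebraic_closure_of (field_gen (range t)))
  (d : 'I_k -> R[i] -> R[i]) (hd : forall j, extends_partial t j (d j))
  (phi : {rmorphism R[i] -> R[i]}) (hphi : bijective phi)
  (hphiS : extends_exponential_of_S1star K a alpha beta phi)
  (J : 'I_k -> nat) (c : multi_index J -> R[i]) :
  let D := diff_op d c in
  let Dphi := diff_op d (fun j => phi (c j)) in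
  let Dphi_ := diff_op_shift d (fun j => phi (c j)) in
  let condA :=
    forall m : multi_index J, (1 <= \sum_i m i)%N ->
      \sum_i a i * Dphi_ m (alpha i) = 0 /\
      \sum_i a i * Dphi_ m (beta i) = 0 in
  let condB (ct : R[i]) :=
    \sum_i a i * Dphi (alpha i) = ct /\ \sum_i a i * Dphi (beta i) = ct in
  (forall ct : R[i],
     (exists2 x, x \in K & phi (D x) != 0) ->
     solves K a alpha beta (fun x => phi (D x)) ct ->
     ct != 0 ->
     [/\ {in K, forall x, phi x = x}, condA & condB ct]) /\
  (forall ct : R[i], ct != 0 -> condA -> condB ct ->
     forall c' : R[i], c' != 0 ->
       let f := fun x => c' / ct * Dphi x in
       [/\ exists2 x, x \in K & f x != 0,
           additive_on K f
         & solves K a alpha beta f c']).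
Proof.
have d_der j : derivation_on K (d j).
  exact: extends_partial_derivation hK hLK hKL (hd j).
have alphaK i : alpha i \in K by apply/mem_set/hKab; left; exact: imageT.
have betaK i : beta i \in K by apply/mem_set/hKab; right; exact: imageT.
have K0 : 0 \in K by exact: (rpred0 (subfield_pred hK)).
have K1 : 1 \in K by exact: (rpred1 (subfield_pred hK)).
have KM : {in K &, forall x y, x * y \in K}.
  by exact: (@rpredM _ (subfield_pred hK)).
move=> D Dphi Dphi_ condA condB.
split=> [ct _ sol ct0|ct ct0 hA [hB1 hB2] c' c'0 f].
  (* Setting [y = 0], and then [x = 0], separates the [alpha] part from the [beta] part, with the
     same constant. *)
  have alphaE : {in K, forall x, \sum_i a i * phi (D (alpha i * x)) = ct * x}.
    move=> x hx; rewrite -[in RHS](addr0 x) -sol //.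
    by apply: eq_bigr => i _; rewrite mulr0 addr0.
  have betaE : {in K, forall x, \sum_i a i * phi (D (beta i * x)) = ct * x}.
    move=> x hx; rewrite -[in RHS](add0r x) -sol //.
    by apply: eq_bigr => i _; rewrite mulr0 add0r.
  have [phi_id coefA] :=
    solution_diff_op_coef hd hK hLK hKL hphi alphaK ct0 alphaE.
  have [_ coefB] := solution_diff_op_coef hd hK hLK hKL hphi betaK ct0 betaE.
  split=> // [m|].
    by rewrite index_sum_gt0 => /negPf m0; rewrite coefA coefB m0.
  (* Condition (B) is the coefficient at index zero, where the shifted operator is [Dphi] itself. *)
  split.
    transitivity (\sum_i a i * Dphi_ (zero_index J) (alpha i)).
      by apply: eq_bigr => i _; rewrite /Dphi_ diff_op_shift0.
    by rewrite coefA eqxx.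
  transitivity (\sum_i a i * Dphi_ (zero_index J) (beta i)).
    by apply: eq_bigr => i _; rewrite /Dphi_ diff_op_shift0.
  by rewrite coefB eqxx.
have DphiD : additive_on K Dphi by exact: diff_op_additive.
have fE (g : 'I_n -> R[i]) : (forall i, g i \in K) ->
    (forall m : multi_index J, (1 <= \sum_i m i)%N ->
       \sum_i a i * Dphi_ m (g i) = 0) ->
    \sum_i a i * Dphi (g i) = ct ->
    {in K, forall x, \sum_i a i * f (g i * x) = c' * x}.
  move=> gK gA gB x hx; rewrite /f.
  under eq_bigr do rewrite mulrCA.
  rewrite -mulr_sumr (diff_op_coef_solution hd hK hLK hKL gK gA gB hx).
  by rewrite mulrA divfK.
have fD : additive_on K f by move=> x y hx hy; rewrite /f DphiD // mulrDr.
have fsol : solves K a alpha beta f c'.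
  move=> x y hx hy; rewrite mulrDr.
  (* The one-variable equations for [alpha] and [beta] add up to the full equation by additivity of
     [f]. *)
  rewrite -(fE alpha alphaK (fun m hm => (hA m hm).1) hB1 x hx).
  rewrite -(fE beta betaK (fun m hm => (hA m hm).2) hB2 y hy) -big_split /=.
  by apply: eq_bigr => i _; rewrite fD ?mulrDr // KM.
(* If [f] vanished on [K], the [alpha] equation at [x = 1] would give [c' = 0]. *)
split=> //; apply: contrapT => f0.
have f_eq0 x : x \in K -> f x = 0.
  by move=> hx; apply/eqP; apply: contraPT f0 => fx; apply; exists x.
move/eqP: c'0; apply; rewrite -(mulr1 c') -(fE alpha alphaK _ hB1 1 K1).
  by apply: big1 => i _; rewrite f_eq0 ?mulr0 // KM.
by move=> m hm; exact: (hA m hm).1.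
Qed.
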